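(* Let $0\le x<1$ and let $s\in\mathbb{C}$ with $\Re(s)>0$. Then $$\varphi(s,x)=\sum_{j=0}^{\infty}\binom{-s}{j}\,\varphi(s+j)\,x^j .$$
   Context: Setting: $\{a_n\}_{n\ge 1}$ is a linear recurrence sequence over $\mathbb{Z}$, i.e. a sequence of integers for which there is a monic $Q\in\mathbb{Z}[X]$ with $Q(\nabla)a_n=0$ for all $n$, where $\nabla a_n=a_{n+1}$. Its minimal polynomial $P\in\mathbb{Z}[X]$ (the monic polynomial of least degree with $P(\nabla)$ annihilating $\{a_n\}$) is assumed irreducible over $\mathbb{Q}$, of degree $r$, with (simple) roots $\alpha_1,\dots,\alpha_r\in\mathbb{C}$, and $\alpha_1$ is a dominant root: $\alpha_1$ is real, $\alpha_1>1$ and $\alpha_1>|\alpha_i|$ for $i=2,\dots,r$. The sequence $\{a_n\}$ is assumed to be a strictly increasing sequence of positive integers. For $\Re(s)>0$ and $0\le x<1$, define $$\varphi(s)=\sum_{n=1}^{\infty}\frac{1}{a_n^s},\qquad \varphi(s,x)=\sum_{n=1}^{\infty}\frac{1}{(a_n+x)^s},$$ with powers defined through the real logarithm of the positive base. For $j\ge 0$, $\binom{-s}{j}=\frac{(-s)(-s-1)\cdots(-s-j+1)}{j!}$ (equal to $1$ for $j=0$), and $x^0=1$ (also for $x=0$). *)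

(* Defs.v *)
From HB Require Import structures.
From mathcomp Require Import all_boot all_order all_algebra.
From mathcomp Require Import complex.
From mathcomp Require Import all_classical all_reals all_analysis.
Set Implicit Arguments.
Unset Strict Implicit.
Unset Printing Implicit Defensive.
Import Order.TTheory GRing.Theory Num.Theory.
Import numFieldNormedType.Exports.
Local Open Scope classical_set_scope.
Local Open Scope complex_scope.
Local Open Scope ring_scope.

(* A sequence {a_n}_{n >= 1} is a function [nat -> int] whose value at 0 is
   irrelevant: every condition and every sum below only involves n >= 1. *)

(* Q(nabla) a_n, where nabla a_n = a_{n+1} *)
Definition shift_poly (Q : {poly int}) (a : nat -> int) (n : nat) : int :=
  \sum_(i < size Q) Q`_i * a (n + i)%N.

Definition annihilates (Q : {poly int}) (a : nat -> int) : Prop :=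
  forall n, (1 <= n)%N -> shift_poly Q a n = 0.

Definition linear_recurrence (a : nat -> int) : Prop :=
  exists2 Q : {poly int}, Q \is monic & annihilates Q a.

Definition minimal_polynomial (P : {poly int}) (a : nat -> int) : Prop :=
  [/\ P \is monic, annihilates P a &
      forall Q : {poly int},
        Q \is monic -> annihilates Q a -> (size P <= size Q)%N].

Definition irreducible_over_rat (P : {poly int}) : Prop :=
  irreducible_poly (map_poly intr P : {poly rat}).

(* alpha_1, ..., alpha_r is the list of complex roots of the monic P *)
Definition complex_roots (R : realType) (P : {poly int}) (r : nat)
    (alpha : nat -> R[i]) : Prop :=
  map_poly intr P = \prod_(1 <= i < r.+1) ('X - (alpha i)%:P).

(* On R[i], [z < w] holds iff 'Im z = 'Im w and 'Re z < 'Re w, and the modulus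
   [`|z|] is a (real) element of R[i]. *)
Definition dominant_root (R : realType) (r : nat) (alpha : nat -> R[i]) : Prop :=
  [/\ alpha 1%N \is Num.real, 1 < alpha 1%N &
      forall i, (2 <= i <= r)%N -> `|alpha i| < alpha 1%N].

Definition cexp (R : realType) (z : R[i]) : R[i] :=
  (expR (complex.Re z))%:C * (cos (complex.Im z) +i* sin (complex.Im z)).

(* t ^ s = exp (s ln t) for a real base t > 0 *)
Definition cpow (R : realType) (t : R) (s : R[i]) : R[i] :=
  cexp (s * (ln t)%:C).

(* [R[i]^o] is R[i] with the topology of its norm. *)
Definition phi_sum (R : realType) (a : nat -> int) (s : R[i]) (N : nat)
    : R[i]^o :=
  \sum_(1 <= n < N.+1) (cpow (a n)%:~R s)^-1.

Definition phix_sum (R : realType) (a : nat -> int) (s : R[i]) (x : R) (N : nat)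
    : R[i]^o :=
  \sum_(1 <= n < N.+1) (cpow ((a n)%:~R + x) s)^-1.

Definition phi (R : realType) (a : nat -> int) (s : R[i]) : R[i]^o :=
  limn (phi_sum a s).

Definition phix (R : realType) (a : nat -> int) (s : R[i]) (x : R) : R[i]^o :=
  limn (phix_sum a s x).

Definition gbinom (R : realType) (z : R[i]) (j : nat) : R[i] :=
  (\prod_(k < j) (z - k%:R)) / (j`!)%:R.

(* Main.v *)
Require Import Defs.
From mathcomp Require Import all_boot all_order all_algebra.
From mathcomp Require Import complex.
From mathcomp Require Import all_classical all_reals all_analysis.
From mathcomp Require Import zify ring lra.
Set Implicit Arguments.
Unset Strict Implicit.
Unset Printing Implicit Defensive.
Import Order.TTheory GRing.Theory Num.Theory.
Import numFieldNormedType.Exports.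
Local Open Scope classical_set_scope.
Local Open Scope complex_scope.
Local Open Scope ring_scope.
Import Normc.

(** The identity itself is Newton's binomial series applied to each term,
    (a_n + x)^-s = a_n^-s (1 + x / a_n)^-s = sum_j binom(-s, j) a_n^(-s-j) x^j,
    which is legitimate since 0 <= x / a_n < 1, followed by an exchange of the
    summations over n and j.  As a_n >= 1, the general term is bounded by the
    product a_n^(- Re s) * |binom(-s, j)| x^j, and both factors are summable
    ([gbinom_cvg] for the second one), so the exchange is the elementary
    [series_exchange].

    The recurrence is needed only to make sum_n a_n^(- Re s) converge for every
    Re s > 0: an increasing sequence of integers gives it for Re s > 1 alone,
    so exponential growth of a_n has to be extracted ([recurrence_growth]).
    Write P = Q (X - beta), where beta > 1 is the dominant root.  The sequence
    Q(nabla) a is geometric of ratio beta and is dominated by a shift of a, so a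
    grows like beta^n unless Q(nabla) a = 0.  That last case is impossible: as P
    is irreducible over the rationals, a and its first deg P - 1 shifts are
    linearly independent over the rationals; this is the invertibility of a
    Hankel matrix, hence it persists over the reals
    ([irreducible_shiftp_neq0_ext]).

    Newton's series for a complex exponent and a real argument
    ([gbinom_series]) is obtained without differentiating a power series: the
    partial sums f satisfy (1 + t) f' + s f = 0 up to one explicit term tending
    to 0, so f(t) (1 + t)^s is nearly constant by the mean value inequality. *)

(** * Polynomials acting on sequences by shifts *)

(** The operator [shift_poly] over an arbitrary commutative ring: the growth
    argument lets rational and real polynomials act on the same sequence. *)
Definition shiftp (A : comNzRingType) (Q : {poly A}) (b : nat -> A) (n : nat) : A :=
  \sum_(i < size Q) Q`_i * b (n + i)%N.

Lemma shiftp_widen (A : comNzRingType) (Q : {poly A}) b n N :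
  (size Q <= N)%N -> shiftp Q b n = \sum_(i < N) Q`_i * b (n + i)%N.
Proof.
move=> QN; rewrite /shiftp (big_ord_widen N (fun i => Q`_i * b (n + i)%N) QN).
rewrite big_mkcond /=; apply: eq_bigr => i _; case: ltnP => // Qi.
by rewrite nth_default ?mul0r.
Qed.

Lemma shiftpD (A : comNzRingType) (Q1 Q2 : {poly A}) b n :
  shiftp (Q1 + Q2) b n = shiftp Q1 b n + shiftp Q2 b n.
Proof.
have le1 := leq_maxl (size Q1) (size Q2); have le2 := leq_maxr (size Q1) (size Q2).
rewrite (shiftp_widen _ _ (size_polyD Q1 Q2)).
rewrite (shiftp_widen _ _ le1) (shiftp_widen _ _ le2) -big_split /=.
by apply: eq_bigr => i _; rewrite coefD mulrDl.
Qed.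

Lemma shiftpC (A : comNzRingType) (c : A) b n : shiftp c%:P b n = c * b n.
Proof.
by rewrite (shiftp_widen _ _ (size_polyC_leq1 c)) big_ord1 coefC addn0.
Qed.

Lemma shiftpMX (A : comNzRingType) (Q : {poly A}) b n :
  shiftp (Q * 'X) b n = shiftp Q b n.+1.
Proof.
have le : (size (Q * 'X)%R <= (size Q).+1)%N.
  by apply: (leq_trans (size_polyMleq _ _)); rewrite size_polyX addn2.
rewrite (shiftp_widen _ _ le) big_ord_recl coefMX mul0r add0r.
by apply: eq_bigr => i _; rewrite coefMX /= addSnnS.
Qed.

(** Sequences form a module over the polynomials, with ['X] acting as the shift:
    this is what turns factorisations and Bezout identities of polynomials into
    statements about recurrences. *)
Lemma shiftpM (A : comNzRingType) (Q1 Q2 : {poly A}) b n :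
  shiftp (Q1 * Q2) b n = shiftp Q1 (shiftp Q2 b) n.
Proof.
elim/poly_ind: Q1 n => [|q c IH] n.
  by rewrite mul0r /shiftp size_poly0 !big_ord0.
rewrite mulrDl -mulrA -(commr_polyX Q2) mulrA shiftpD shiftpMX IH.
rewrite [RHS]shiftpD shiftpMX shiftpC; congr (_ + _).
rewrite mul_polyC (shiftp_widen _ _ (size_scale_leq c Q2)) mulr_sumr.
by apply: eq_bigr => i _; rewrite coefZ mulrA.
Qed.

Lemma shiftp0 (A : comNzRingType) (Q : {poly A}) b n :
  (forall m, b m = 0) -> shiftp Q b n = 0.
Proof. by move=> b0; rewrite /shiftp big1 // => i _; rewrite b0 mulr0. Qed.

Lemma shiftp_monic_eq0 (A : comNzRingType) (P : {poly A}) u r :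
  P \is monic -> size P = r.+1 -> (forall n, shiftp P u n = 0) ->
  (forall n, (n < r)%N -> u n = 0) -> forall n, u n = 0.
Proof.
move=> /monicP Pm sP Pu u0; elim/ltn_ind => n IH.
have [/u0 //|rn] := ltnP n r.
have := Pu (n - r)%N; rewrite /shiftp sP big_ord_recr /= big1 => [|i _].
  by rewrite add0r subnK // -[r in P`_r]/(r.+1.-1) -sP -/(lead_coef P) Pm mul1r.
rewrite IH ?mulr0 //; have := ltn_ord i; lia.
Qed.

(** If a nonzero [V] of degree less than [r] killed the first [r] values, then
    [V] would kill the whole sequence, since [shiftp V a] also satisfies the
    recurrence of order [r]; but [V] is coprime to the irreducible [P], so by
    Bezout the sequence would vanish. *)
Lemma irreducible_shiftp_neq0 (F : fieldType) (P V : {poly F}) a r :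
  irreducible_poly P -> P \is monic -> size P = r.+1 ->
  (forall n, shiftp P a n = 0) -> a 0 != 0 -> (size V <= r)%N ->
  (forall n, (n < r)%N -> shiftp V a n = 0) -> V = 0.
Proof.
move=> Pirr Pm sP Pa a0 sV Va.
have Va0 : forall n, shiftp V a n = 0.
  apply: (shiftp_monic_eq0 Pm sP) => // n.
  by rewrite -shiftpM mulrC shiftpM shiftp0.
apply/eqP; apply: contraT => V0.
have : coprimep P V.
  rewrite irreducible_poly_coprime //; apply/negP => /(dvdp_leq V0).
  by rewrite sP ltnNge sV.
case/Bezout_eq1_coprimepP => -[U W] /= UW.
suff : a 0 = 0 by move/eqP; rewrite (negbTE a0).
have <- : shiftp 1%:P a 0 = a 0 by rewrite shiftpC mul1r.
by rewrite -[1%:P]/(1 : {poly F}) -UW shiftpD !shiftpM !shiftp0 // addr0.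
Qed.

(** Passing to the invertible Hankel matrix [a (i + j)] transports the previous
    independence from the base field to an extension. *)
Lemma irreducible_shiftp_neq0_ext (F K : fieldType) (f : {rmorphism F -> K})
    (P : {poly F}) (Q : {poly K}) a r :
  irreducible_poly P -> P \is monic -> size P = r.+1 ->
  (forall n, shiftp P a n = 0) -> a 0 != 0 -> (size Q <= r)%N ->
  (forall n, shiftp Q (f \o a) n = 0) -> Q = 0.
Proof.
move=> Pirr Pm sP Pa a0 sQ Qa.
(* A row vector [v] satisfies [v *m H = 0] exactly when the polynomial with
   coefficients [v] kills the first [r] terms of the sequence. *)
pose H : 'M[F]_r := \matrix_(i, j) a (j + i)%N.
have Hfree : row_free H.
  apply: inj_row_free => v vH; rewrite -[v]rVpolyK.
  rewrite (irreducible_shiftp_neq0 (V := rVpoly v) Pirr Pm sP Pa a0) ?linear0 ?size_poly //.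
  move=> n nr; rewrite (shiftp_widen _ _ (size_poly _ _)).
  have := congr1 (fun w : 'rV_r => w 0 (Ordinal nr)) vH; rewrite !mxE => e; rewrite -[RHS]e.
  by apply: eq_bigr => i _; rewrite coef_rVpoly_ord mxE.
rewrite -(poly_rV_K sQ); suff -> : poly_rV Q = 0 :> 'rV_r by rewrite linear0.
rewrite -(row_free_map f) in Hfree; apply/eqP; rewrite -(mulmx_free_eq0 _ Hfree).
apply/eqP/rowP => j; rewrite !mxE -[RHS](Qa j) (shiftp_widen _ _ sQ).
by apply: eq_bigr => i _; rewrite !mxE.
Qed.

(** * Exponential growth of the sequence *)

Lemma shiftp_map (A B : comNzRingType) (f : {rmorphism A -> B}) (Q : {poly A}) b n :
  shiftp (map_poly f Q) (f \o b) n = f (shiftp Q b n).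
Proof.
rewrite (shiftp_widen _ _ (size_poly _ _)) rmorph_sum.
by apply: eq_bigr => i _; rewrite coef_map rmorphM.
Qed.

Lemma shiftpXsubC (A : comNzRingType) (c : A) b n :
  shiftp ('X - c%:P) b n = b n.+1 - c * b n.
Proof.
by rewrite -['X]mul1r -polyCN shiftpD shiftpMX !shiftpC mul1r mulNr.
Qed.

Lemma norm_shiftp_le (R : realType) (Q : {poly R}) (b : nat -> R) r n :
  {homo b : m n / (m <= n)%N >-> m <= n} -> 0 <= b 0 -> (size Q <= r.+1)%N ->
  `|shiftp Q b n| <= (\sum_(i < r.+1) `|Q`_i|) * b (n + r)%N.
Proof.
move=> bh b0 sQ; rewrite (shiftp_widen _ _ sQ) mulr_suml.
apply: (le_trans (ler_norm_sum _ _ _)); apply: ler_sum => i _; rewrite normrM.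
have bge0 m : 0 <= b m by apply: (le_trans b0); exact: bh.
rewrite ler_wpM2l // ger0_norm //; apply: bh; have := ltn_ord i; lia.
Qed.

(** If [Q * ('X - beta)] kills [b], then [shiftp Q b] is geometric with ratio
    [beta]; as soon as it is nonzero, the finitely many coefficients of [Q]
    force [b] itself to grow like [beta ^+ n]. *)
Lemma shiftp_growth (R : realType) (Q : {poly R}) (b : nat -> R) (beta : R) r :
  {homo b : m n / (m <= n)%N >-> m <= n} -> 1 <= b 0 -> 1 < beta ->
  (size Q <= r.+1)%N -> (forall n, shiftp (Q * ('X - beta%:P)) b n = 0) ->
  ~ (forall n, shiftp Q b n = 0) ->
  exists2 c, 0 < c & forall n, c * beta ^+ n <= b n.
Proof.
move=> bh b0 beta1 sQ Qb nQ; pose y := shiftp Q b.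
have bge1 m : 1 <= b m by apply: (le_trans b0); exact: bh.
have beta0 : 0 < beta by apply: lt_trans beta1.
have betaX_ge0 n : 0 <= beta ^+ n by rewrite exprn_ge0 // ltW.
have ygeo n : y n = beta ^+ n * y 0.
  elim: n => [|n IH]; first by rewrite mul1r.
  have := Qb n; rewrite mulrC shiftpM shiftpXsubC => /eqP; rewrite subr_eq0.
  by move/eqP; rewrite -/y IH exprS mulrA.
have y0 : 0 < `|y 0|.
  rewrite normr_gt0; apply/eqP => y0; apply: nQ => n.
  by rewrite -/(y n) ygeo y0 mulr0.
pose C := \sum_(i < r.+1) `|Q`_i|.
have ybd n : beta ^+ n * `|y 0| <= C * b (n + r)%N.
  rewrite -[beta ^+ n]ger0_norm // -normrM -ygeo.
  by apply: norm_shiftp_le => //; apply: le_trans b0.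
have C0 : 0 < C.
  have : 0 < C * b (0 + r)%N by apply: lt_le_trans (ybd 0); rewrite mul1r.
  by rewrite pmulr_lgt0 //; apply: lt_le_trans (bge1 _).
(* The bound [ybd] speaks of [b (n + r)]: dividing by [beta ^+ r] absorbs the
   shift, and the minimum with 1 handles the first [r] terms, where [b >= 1]. *)
exists (Num.min 1 (`|y 0| / C) / beta ^+ r).
  by rewrite divr_gt0 ?exprn_gt0 // lt_min ltr01 divr_gt0.
move=> n; rewrite mulrAC -mulrA.
have [nr|rn] := ltnP n r.
  apply: le_trans (bge1 n); apply: mulr_ile1; rewrite ?le_min ?ler01 ?divr_ge0 ?betaX_ge0 ?ge_min ?lexx //.
  - exact: ltW.
  - by rewrite ler_pdivrMr ?exprn_gt0 // mul1r ler_eXn2l // ltnW.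
rewrite -{1 2}(subnK rn) exprD mulfK ?expf_neq0 ?gt_eqF //.
apply: (@le_trans _ _ (`|y 0| / C * beta ^+ (n - r))).
  by rewrite ler_wpM2r // ge_min lexx orbT.
by rewrite mulrAC ler_pdivrMr // mulrC [leRHS]mulrC subnK // -[in leRHS](subnK rn).
Qed.

(** The linear recurrence enters the theorem only through this exponential
    lower bound.  Irreducibility is what guarantees that the dominant root is
    really present in the closed form of the sequence. *)
Lemma recurrence_growth (R : realType) (a : nat -> int) (P : {poly int}) (r : nat)
    (alpha : nat -> R[i]) :
  minimal_polynomial P a -> irreducible_over_rat P -> size P = r.+1 ->
  complex_roots P r alpha -> dominant_root r alpha ->
  (forall n, (1 <= n)%N -> 0 < a n) ->
  (forall m n, (1 <= m)%N -> (m < n)%N -> a m < a n) ->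
  exists2 beta : R, 1 < beta &
    exists2 c, 0 < c & forall n, c * beta ^+ n <= (a n.+1)%:~R.
Proof.
move=> [Pm Pa _] Pirr sP Proots [alpha_real alpha_gt1 _] apos aincr.
have Pb n : shiftp P (a \o succn) n = 0 by rewrite -(Pa n.+1).
have sPF (F : numFieldType) : size (map_poly intr P : {poly F}) = r.+1.
  by rewrite size_map_inj_poly //; exact: intr_inj.
have [r' rE] : exists r', r = r'.+1.
  by case: Pirr; rewrite sPF; case: (r) => // r' _ _; exists r'.
have /complex_realP[beta betaE] := alpha_real.
have beta1 : 1 < beta by move: alpha_gt1; rewrite betaE -[1]/(1%:C) ltcR.
exists beta => //.
have /factor_theorem[Q PQ] : root (map_poly intr P : {poly R}) beta.
  rewrite -(fmorph_root (real_complex R)) -map_poly_comp.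
  rewrite (eq_map_poly (g := intr)) => [|z]; last by rewrite /= rmorph_int.
  rewrite Proots rE big_nat_recl //= rootM betaE.
  by rewrite root_XsubC eqxx.
have Q0 : Q != 0.
  by apply: contra_eq_neq (sPF R) => /=; rewrite PQ => ->; rewrite mul0r size_poly0.
have sQ : size Q = r.
  by have := sPF R; rewrite PQ size_Mmonic ?monicXsubC // size_XsubC addn2 => -[].
apply: (@shiftp_growth R Q _ beta r') => //.
- move=> m n mn /=; rewrite ler_int; case: ltngtP mn => // [mn _|-> //].
  by apply/ltW/aincr.
- by rewrite /= ler1z -gtz0_ge1 apos.
- by rewrite sQ rE.
- by move=> n; rewrite -PQ (shiftp_map intr P (a \o succn)) Pb.
- move=> Qb; move/eqP: Q0; apply.
  apply: (@irreducible_shiftp_neq0_ext rat R ratr (map_poly intr P) Q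
    (intr \o (a \o succn)) r) => //.
  + exact: monic_map.
  + exact: (sPF rat).
  + by move=> n; rewrite shiftp_map Pb.
  + by rewrite /= intr_eq0 gt_eqF ?apos.
  + by rewrite sQ.
  + move=> n; rewrite -[RHS](Qb n) /shiftp; apply: eq_bigr => i _.
    by rewrite /= ratr_int.
Qed.

(** * Convergence in the complex numbers *)

Lemma normc_ge0 (R : rcfType) (z : R[i]) : 0 <= normc z.
Proof. by case: z => x y; exact: sqrtr_ge0. Qed.

Lemma ler_Re_normc (R : rcfType) (z : R[i]) : `|complex.Re z| <= normc z.
Proof. by rewrite -lecR; exact: normc_ge_Re. Qed.

Lemma ler_Im_normc (R : rcfType) (z : R[i]) : `|complex.Im z| <= normc z.
Proof. by case: z => x y; rewrite -sqrtr_sqr ler_sqrt ?lerDr ?sqr_ge0 // addr_ge0 ?sqr_ge0. Qed.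

Lemma normc_real (R : rcfType) (x : R) : normc x%:C = `|x|.
Proof. by rewrite /= expr0n addr0 sqrtr_sqr. Qed.

Lemma normc_nat (R : rcfType) n : normc n%:R = n%:R :> R.
Proof. by rewrite -[n%:R](rmorph_nat (real_complex R)) normc_real normr_nat. Qed.

Lemma ler_normc_ReIm (R : rcfType) (z : R[i]) :
  normc z <= `|complex.Re z| + `|complex.Im z|.
Proof.
rewrite {1}[z]complexE (le_trans (le_normcD _ _)) // normcM !normc_real.
by rewrite -[normc 'i]/(Num.sqrt _) /= expr0n add0r expr1n sqrtr1 mul1r.
Qed.

Lemma ler_normc_sum (R : rcfType) (F : nat -> R[i]) (m n : nat) :
  normc (\sum_(m <= i < n) F i) <= \sum_(m <= i < n) normc (F i).
Proof.
elim/big_ind2 : _ => // [|x1 y1 x2 y2 le1 le2]; first by rewrite normc0.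
by rewrite (le_trans (le_normcD _ _)) // lerD.
Qed.

Lemma cvgc_normcP (R : realType) (u : nat -> R[i]^o) (l : R[i]^o) :
  u @ \oo --> l <-> (fun n => normc (l - u n)) @ \oo --> (0 : R).
Proof.
split=> [/cvgrPdist_lt ul|/cvgrPdist_lt ul].
  apply/cvgrPdist_lt => e e0; have : 0 < e%:C by rewrite ltcR.
  move=> /ul; apply: filterS => n un; rewrite sub0r normrN ger0_norm ?normc_ge0 //.
  by have : (normc (l - u n))%:C < e%:C := un; rewrite ltcR.
apply/cvgrPdist_lt => e; rewrite ltcE => /andP[/eqP e_real e_gt0].
have := ul _ e_gt0; apply: filterS => n.
by rewrite sub0r normrN ger0_norm ?normc_ge0 // ltcE e_real eqxx.
Qed.

Lemma cvgc_bound (R : realType) (u : nat -> R[i]^o) (l : R[i]^o) (e : nat -> R) :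
  (forall n, normc (l - u n) <= e n) -> e @ \oo --> (0 : R) -> u @ \oo --> l.
Proof.
move=> ue e0; apply/cvgc_normcP.
apply: (squeeze_cvgr _ (cvg_cst 0) e0).
by apply: nearW => n; rewrite normc_ge0 ue.
Qed.

Lemma normc_lim_le (R : realType) (u : nat -> R[i]^o) (l z : R[i]^o) (B : R) :
  u @ \oo --> l -> (\forall n \near \oo, normc (u n - z) <= B) ->
  normc (l - z) <= B.
Proof.
move=> /cvgc_normcP/cvgrPdist_lt ul uz; apply/ler_addgt0Pr => e e0.
near \oo => n.
rewrite -(subrKA (u n)) (le_trans (le_normcD _ _)) // addrC lerD //.
  by near: n.
have : `|0 - normc (l - u n)| < e by near: n; exact: ul.
by rewrite sub0r normrN ger0_norm ?normc_ge0 // => /ltW.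
Unshelve. all: by end_near. Qed.

(** The real and imaginary parts of the terms are at most [normc (z n)] in
    absolute value, so both real series converge absolutely. *)
Lemma normc_series_cvg (R : realType) (z : nat -> R[i]) (v : nat -> R) :
  (forall n, normc (z n) <= v n) -> cvgn (series v) ->
  cvgn (fun N : nat => \sum_(0 <= n < N) z n : R[i]^o).
Proof.
move=> zv vcvg.
have part (p : {additive R[i] -> R}) : (forall w, `|p w| <= normc w) ->
    exists l : R, (fun N : nat => p (\sum_(0 <= n < N) z n)) @ \oo --> l.
  move=> pnorm; exists (limn (series (p \o z))).
  have -> : (fun N => p (\sum_(0 <= n < N) z n)) = series (p \o z).
    by apply/funext => N; rewrite raddf_sum.
  apply/normed_cvg; apply: series_le_cvg vcvg => n; rewrite /= ?normr_ge0 //.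
    by rewrite (le_trans _ (zv n)) ?normc_ge0.
  by rewrite (le_trans _ (zv n)).
have [x zx] := part _ (@ler_Re_normc R).
have [y zy] := part _ (@ler_Im_normc R).
apply/cvg_ex; exists (x +i* y : R[i]^o).
apply: (@cvgc_bound _ _ _ (fun N =>
  `|x - complex.Re (\sum_(0 <= n < N) z n)| +
  `|y - complex.Im (\sum_(0 <= n < N) z n)|)).
  by move=> N; rewrite (le_trans (ler_normc_ReIm _)) // !raddfB.
have -> : 0 = `|x - x| + `|y - y| :> R by rewrite !subrr normr0 addr0.
by apply: cvgD; apply: cvg_norm; apply: cvgB => //; exact: cvg_cst.
Qed.

(** * Exchange of summations *)

(** Fubini for a double series dominated by a product [u n * v j]: the tail of
    the inner series at [n] is at most [u n] times the tail of [v], so the error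
    made by truncating all the inner series at [J] is at most [sum u] times
    that tail, uniformly in the number of terms of the outer series. *)
Lemma series_exchange (R : realType) (F : nat -> nat -> R[i]) (f : nat -> R[i])
    (u v : nat -> R) :
  (forall n, 0 <= u n) -> (forall j, 0 <= v j) ->
  cvgn (series u) -> cvgn (series v) ->
  (forall n j, normc (F n j) <= u n * v j) ->
  (forall n, (fun J : nat => \sum_(0 <= j < J) F n j : R[i]^o) @ \oo --> (f n : R[i]^o)) ->
  [/\ cvgn (fun N : nat => \sum_(0 <= n < N) f n : R[i]^o),
      forall j, cvgn (fun N : nat => \sum_(0 <= n < N) F n j : R[i]^o) &
      (fun J : nat => \sum_(0 <= j < J)
         limn (fun N : nat => \sum_(0 <= n < N) F n j : R[i]^o) : R[i]^o) @ \oo -->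
      limn (fun N : nat => \sum_(0 <= n < N) f n : R[i]^o)].
Proof.
move=> u0 v0 ucvg vcvg Fuv Ff.
pose T J := limn (series v) - series v J.
(* Compare the partial sums up to [K] and [J], then let [K] tend to infinity. *)
have tailF n J : normc (f n - \sum_(0 <= j < J) F n j) <= u n * T J.
  apply: (@normc_lim_le _ _ (f n) _ _ (Ff n)); near=> K.
  have JK : (J <= K)%N by near: K; exact: nbhs_infty_ge.
  rewrite (big_cat_nat (n := J)) //= addrAC subrr add0r.
  rewrite (le_trans (ler_normc_sum _ _ _)) //.
  apply: (@le_trans _ _ (\sum_(J <= j < K) u n * v j)); first exact: ler_sum.
  rewrite -mulr_sumr ler_wpM2l // /T -sub_series_geq // lerD2r.
  by apply: nondecreasing_cvgn_le => //; exact: nondecreasing_series.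
have fcvg : cvgn (fun N : nat => \sum_(0 <= n < N) f n : R[i]^o).
  apply: (@normc_series_cvg _ _ (fun n => T 0 * u n)).
    by move=> n; have := tailF n 0; rewrite big_geq // subr0 mulrC.
  exact: is_cvg_seriesZ.
have Fcvg j : cvgn (fun N : nat => \sum_(0 <= n < N) F n j : R[i]^o).
  apply: (@normc_series_cvg _ _ (fun n => v j * u n)).
    by move=> n; rewrite mulrC.
  exact: is_cvg_seriesZ.
split=> //.
have T0 J : 0 <= T J.
  by rewrite subr_ge0 nondecreasing_cvgn_le //; exact: nondecreasing_series.
apply: (@cvgc_bound _ _ _ (fun J => limn (series u) * T J)); last first.
  rewrite -(mulr0 (limn (series u))); apply: cvgMr.
  by rewrite -(subrr (limn (series v))); apply: cvgB => //; exact: cvg_cst.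
move=> J; rewrite -[_ - _]subr0.
apply: (@normc_lim_le _ (fun N => \sum_(0 <= n < N) f n -
    \sum_(0 <= j < J) \sum_(0 <= n < N) F n j)).
  apply: cvgB; first exact: fcvg.
  by apply: cvg_big => [|j _]; [exact: add_continuous|exact: Fcvg].
near=> N; rewrite subr0 exchange_big /= -sumrB.
rewrite (le_trans (ler_normc_sum _ _ _)) //.
apply: (@le_trans _ _ (\sum_(0 <= n < N) u n * T J)); first exact: ler_sum.
rewrite -mulr_suml ler_wpM2r //.
by apply: (nondecreasing_cvgn_le (u_ := series u)) => //; exact: nondecreasing_series.
Unshelve. all: by end_near. Qed.

(** * Newton's binomial series *)

Lemma ratio_test (R : realType) (w : nat -> R) (q : R) (N : nat) :
  (forall n, 0 <= w n) -> 0 < q -> q < 1 ->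
  (forall n, (N <= n)%N -> w n.+1 <= q * w n) -> cvgn (series w).
Proof.
(* [K] makes [w n <= K * q ^+ n] true at every [n <= N], one summand each. *)
move=> w0 q0 q1 wq; pose K := \sum_(i < N.+1) w i / q ^+ i.
have qX_gt0 n : 0 < q ^+ n by exact: exprn_gt0.
have wK n : w n <= K * q ^+ n.
  have small m : (m <= N)%N -> w m <= K * q ^+ m.
    rewrite -ltnS => mN; rewrite -ler_pdivrMr //.
    rewrite /K (bigD1 (Ordinal mN)) //= lerDl sumr_ge0 // => i _.
    by rewrite divr_ge0 // ltW.
  elim: n => [|n IH]; first exact: small.
  have [/small //|Nn] := leqP n.+1 N.
  by rewrite (le_trans (wq _ _)) // exprS mulrCA ler_pM2l.
apply: (@series_le_cvg _ _ (geometric K q)) => //.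
- by move=> n; rewrite (le_trans (w0 n)) // wK.
- by apply: is_cvg_geometric_series; rewrite ger0_norm // ltW.
Qed.

Section binomial_series.
Context {R : realType}.
Implicit Types (z s : R[i]) (x y t : R).

Lemma gbinom0 z : gbinom z 0 = 1.
Proof. by rewrite /gbinom big_ord0 divr1. Qed.

Lemma gbinomS z j : j.+1%:R * gbinom z j.+1 = (z - j%:R) * gbinom z j.
Proof.
rewrite /gbinom big_ord_recr /= factS natrM.
have := pnatr_eq0 R[i] j.+1; have := pnatr_eq0 R[i] j`!.
rewrite -[(j`! == 0)%N]negbK -lt0n fact_gt0 /= => /negbT f0 /negbT j0.
by move: (j.+1)%:R j0 (j`!)%:R f0 => m m0 f f0; field; rewrite m0 f0.
Qed.

(** The ratio of consecutive terms tends to [x], so it is eventually below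
    [(1 + x) / 2].  The factor [j] serves the error term of [gbinom_series],
    which comes from a derivative. *)
Lemma gbinom_moment_cvg z x : 0 <= x -> x < 1 ->
  cvgn (series (fun j => j%:R * normc (gbinom z j) * x ^+ j)).
Proof.
move=> x0 x1; pose q := (1 + x) / 2.
pose N := (Num.truncn (normc z * x / (q - x))).+1.
apply: (@ratio_test _ _ q N); rewrite /q; [|lra|lra|].
  by move=> n; rewrite !mulr_ge0 ?normc_ge0 ?exprn_ge0.
move=> n Nn; rewrite -(normc_nat R n.+1) -normcM gbinomS normcM.
have n0 : 0 < n%:R :> R by rewrite ltr0n; apply: leq_ltn_trans Nn.
have zn : normc z * x <= (q - x) * n%:R.
  rewrite [leRHS]mulrC -ler_pdivrMr; last by rewrite /q; lra.
  by rewrite (le_trans (ltW (truncnS_gt _))) // ler_nat.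
have zn' : normc (z - n%:R) * x <= q * n%:R.
  rewrite (@le_trans _ _ ((normc z + n%:R) * x)) //.
    by rewrite ler_wpM2r // (le_trans (le_normcD _ _)) // normcN normc_nat.
  by move: zn; rewrite /q; lra.
rewrite exprS; set b := normc (gbinom z n).
have -> : normc (z - n%:R) * b * (x * x ^+ n) = normc (z - n%:R) * x * (b * x ^+ n).
  by ring.
rewrite (@le_trans _ _ (q * n%:R * (b * x ^+ n))) //.
  by rewrite ler_wpM2r // mulr_ge0 ?normc_ge0 ?exprn_ge0.
by rewrite !mulrA.
Qed.

Lemma gbinom_cvg z x : 0 <= x -> x < 1 ->
  cvgn (series (fun j => normc (gbinom z j) * x ^+ j)).
Proof.
move=> x0 x1; apply: (@series_le_cvg _ _
    ((fun j => j%:R * normc (gbinom z j) * x ^+ j) + geometric 1 x)).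
- by move=> j; rewrite mulr_ge0 ?normc_ge0 ?exprn_ge0.
- by move=> j /=; rewrite addr_ge0 ?mulr_ge0 ?normc_ge0 ?exprn_ge0.
(* The factor [j] makes the moment series lose only the term at [j = 0]; the
   geometric series makes up for it. *)
- case=> [|j]; rewrite fctE /=; first by rewrite gbinom0 normc1 !mul0r add0r.
  rewrite ler_wpDr ?mul1r ?exprn_ge0 // ler_wpM2r ?exprn_ge0 //.
  by rewrite ler_peMl ?normc_ge0 // ler1n.
- apply: is_cvg_seriesD; first exact: gbinom_moment_cvg.
  by apply: is_cvg_geometric_series; rewrite ger0_norm.
Qed.

Lemma cexp0 : cexp 0 = 1 :> R[i].
Proof. by rewrite /cexp /= expR0 cos0 sin0 mul1r. Qed.

Lemma cexpD z w : cexp (z + w) = cexp z * cexp w.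
Proof.
case: z w => a b [c d]; rewrite /cexp /= expRD cosD sinD.
by apply/eqP; rewrite eq_complex /=; apply/andP; split; apply/eqP; ring.
Qed.

Lemma normc_cexp z : normc (cexp z) = expR (complex.Re z).
Proof.
rewrite /cexp normcM normc_real ger0_norm ?expR_ge0 //=.
by rewrite cos2Dsin2 sqrtr1 mulr1.
Qed.

Lemma cexp_neq0 z : cexp z != 0.
Proof.
by apply: contraTneq (expR_gt0 (complex.Re z)) => z0; rewrite -normc_cexp z0 normc0 ltxx.
Qed.

Lemma cpowM s x y : 0 < x -> 0 < y -> cpow (x * y) s = cpow x s * cpow y s.
Proof. by move=> x0 y0; rewrite /cpow lnM ?posrE // rmorphD mulrDr cexpD. Qed.

Lemma cpowDn s x j : 0 < x -> cpow x (s + j%:R) = cpow x s * x%:C ^+ j.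
Proof.
move=> x0; elim: j => [|j IH]; first by rewrite addr0 mulr1.
rewrite exprSr -addn1 natrD addrA /cpow mulrDl mul1r cexpD -/(cpow x _) IH mulrA.
by congr (_ * _); rewrite /cexp /= lnK ?posrE // cos0 sin0 mulr1.
Qed.

Lemma normc_cpow x s : normc (cpow x s) = expR (complex.Re s * ln x).
Proof. by rewrite normc_cexp; case: s => a b /=; rewrite mulr0 subr0. Qed.

Lemma cpow1 s : cpow 1 s = 1.
Proof. by rewrite /cpow ln1 mulr0 cexp0. Qed.

(** Differentiability of a complex-valued function of a real variable, taken
    componentwise so that real derivatives and the real mean value theorem
    apply. *)
Definition is_cderive t (f : R -> R[i]) (df : R[i]) :=
  is_derive t 1 (@complex.Re R \o f) (complex.Re df) /\
  is_derive t 1 (@complex.Im R \o f) (complex.Im df).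

Lemma is_cderiveM t f g df dg : is_cderive t f df -> is_cderive t g dg ->
  is_cderive t (f * g) (df * g t + f t * dg).
Proof.
move=> [fr fi] [gr gi]; split.
  have -> : @complex.Re R \o (f * g) = (@complex.Re R \o f) * (@complex.Re R \o g) -
      (@complex.Im R \o f) * (@complex.Im R \o g).
    by apply/funext => u /=; rewrite !fctE /=; case: (f u) (g u) => ? ? [? ?].
  apply: (is_derive_eq (is_deriveB (is_deriveM fr gr) (is_deriveM fi gi))) => /=.
  case: (f t) (g t) df dg {fr fi gr gi} => ? ? [? ?] [? ?] [? ?] /=.
  rewrite /GRing.scale /=; ring.
have -> : @complex.Im R \o (f * g) = (@complex.Re R \o f) * (@complex.Im R \o g) +
    (@complex.Im R \o f) * (@complex.Re R \o g).
  by apply/funext => u /=; rewrite !fctE /=; case: (f u) (g u) => ? ? [? ?].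
apply: (is_derive_eq (is_deriveD (is_deriveM fr gi) (is_deriveM fi gr))) => /=.
case: (f t) (g t) df dg {fr fi gr gi} => ? ? [? ?] [? ?] [? ?] /=.
rewrite /GRing.scale /=; ring.
Qed.

Lemma is_cderive_cexp t s (h : R -> R) (dh : R) : is_derive t 1 h dh ->
  is_cderive t (fun u => cexp (s * (h u)%:C)) (s * dh%:C * cexp (s * (h t)%:C)).
Proof.
move=> hd; case: s => a b; split.
  have -> : @complex.Re R \o (fun u => cexp ((a +i* b) * (h u)%:C)) =
      (expR \o (a *: h)) * (cos \o (b *: h)).
    apply/funext => u /=; rewrite !fctE /cexp /= /GRing.scale /=.
    by rewrite !mulr0 !mul0r !subr0 !add0r.
  apply: is_derive_eq; rewrite /= /cexp /= /GRing.scale /=.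
  by rewrite !mulr0 !mul0r !subr0 !add0r !addr0; ring.
have -> : @complex.Im R \o (fun u => cexp ((a +i* b) * (h u)%:C)) =
    (expR \o (a *: h)) * (sin \o (b *: h)).
  apply/funext => u /=; rewrite !fctE /cexp /= /GRing.scale /=.
  by rewrite !mulr0 !mul0r !subr0 !add0r ?addr0.
apply: is_derive_eq; rewrite /= /cexp /= /GRing.scale /=.
by rewrite !mulr0 !mul0r !subr0 !add0r !addr0; ring.
Qed.

Lemma is_cderive_sum t n (c : nat -> R[i]) :
  is_cderive t (fun u => \sum_(0 <= j < n) c j * u%:C ^+ j)
    (\sum_(0 <= j < n) c j * (j%:R * t%:C ^+ j.-1)).
Proof.
elim: n => [|n [IHr IHi]].
  have p0 (p : {additive R[i] -> R}) : is_derive t 1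
      (p \o (fun u : R => \sum_(0 <= j < 0) c j * u%:C ^+ j))
      (p (\sum_(0 <= j < 0) c j * (j%:R * t%:C ^+ j.-1))).
    have -> : p \o (fun u : R => \sum_(0 <= j < 0) c j * u%:C ^+ j) = cst 0.
      by apply/funext => u /=; rewrite big_geq // raddf0.
    by rewrite big_geq // raddf0; exact: is_derive_cst.
  by split; [exact: (p0 (@complex.Re R))|exact: (p0 (@complex.Im R))].
have monoE (p : {additive R[i] -> R}) : (forall w y, p (w * y%:C) = p w * y) ->
    is_derive t 1 (p \o (fun u => \sum_(0 <= j < n) c j * u%:C ^+ j))
      (p (\sum_(0 <= j < n) c j * (j%:R * t%:C ^+ j.-1))) ->
    is_derive t 1 (p \o (fun u => \sum_(0 <= j < n.+1) c j * u%:C ^+ j))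
      (p (\sum_(0 <= j < n.+1) c j * (j%:R * t%:C ^+ j.-1))).
  move=> pZ IH.
  have -> : p \o (fun u => \sum_(0 <= j < n.+1) c j * u%:C ^+ j) =
      (p \o (fun u => \sum_(0 <= j < n) c j * u%:C ^+ j)) + p (c n) *: (id ^+ n).
    apply/funext => u; rewrite !fctE /= big_nat_recr //= raddfD -rmorphXn pZ.
    by [].
  apply: (is_derive_eq (is_deriveD IH (is_deriveZ _ (is_deriveX n (is_derive_id t 1))))).
  rewrite big_nat_recr //= raddfD; congr (_ + _).
  rewrite -(rmorph_nat (real_complex R)) -rmorphXn -rmorphM pZ.
  by rewrite /GRing.scale /= mulr1 mulr_natl.
split.
- by apply: (monoE (@complex.Re R)) => // -[a b] y /=; rewrite mulr0 subr0.
- by apply: (monoE (@complex.Im R)) => // -[a b] y /=; rewrite mulr0 add0r.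
Qed.

(** A complex-valued function has no mean value equality; applying the real one
    to each component costs the factor 2. *)
Lemma cmean_value (g dg : R -> R[i]) y (B : R) : 0 <= y ->
  (forall t, 0 <= t -> t <= y -> is_cderive t g (dg t)) ->
  (forall t, 0 <= t -> t <= y -> normc (dg t) <= B) ->
  normc (g y - g 0) <= 2 * B * y.
Proof.
move=> y0 gd dgB.
have part (p : {additive R[i] -> R}) : (forall w, `|p w| <= normc w) ->
    (forall t, 0 <= t -> t <= y -> is_derive t 1 (p \o g) (p (dg t))) ->
    `|p (g y - g 0)| <= B * y.
  move=> pn pd; rewrite raddfB.
  have [||t] := @MVT_segment R (p \o g) (p \o dg) 0 y y0.
  - by move=> t; rewrite in_itv /= => /andP[t0 ty]; apply: pd; exact: ltW.
  - apply: derivable_within_continuous => t; rewrite in_itv /= => /andP[t0 ty].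
    by have := pd t t0 ty; case.
  rewrite in_itv /= => /andP[t0 ty] ->; rewrite subr0 normrM (ger0_norm y0).
  by rewrite ler_wpM2r // (le_trans (pn _)) // dgB.
rewrite (le_trans (ler_normc_ReIm _)) // -mulrA mulrDl mul1r lerD //.
  by apply: part => [w|t t0 ty]; [exact: ler_Re_normc|case: (gd t t0 ty)].
by apply: part => [w|t t0 ty]; [exact: ler_Im_normc|case: (gd t t0 ty)].
Qed.

(** The truncated binomial series satisfies [(1 + t) f' + s f = 0] up to the
    single boundary term that the recurrence of the coefficients leaves. *)
Lemma gbinom_sum_ode s (w : R[i]) n :
  (\sum_(0 <= j < n) gbinom (- s) j * (j%:R * w ^+ j.-1)) * (1 + w) +
    s * (\sum_(0 <= j < n) gbinom (- s) j * w ^+ j) =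
  - (n%:R * gbinom (- s) n * w ^+ n.-1).
Proof.
elim: n => [|n IH]; first by rewrite !big_geq // !mul0r mulr0 add0r oppr0.
rewrite !big_nat_recr //= gbinomS.
move: (\sum_(0 <= j < n) _) (\sum_(0 <= j < n) _) IH => B A IH.
(* The factor [n] hides the truncated predecessor at [n = 0]. *)
have wn : n%:R * w ^+ n.-1 * w = n%:R * w ^+ n.
  by case: n {IH} => [|n]; rewrite ?mul0r //= -mulrA -exprSr.
transitivity (A * (1 + w) + s * B + gbinom (- s) n *
    (n%:R * w ^+ n.-1 + n%:R * w ^+ n.-1 * w + s * w ^+ n)); first by ring.
by rewrite IH wn; ring.
Qed.

(** Newton's series on [0, 1).  With [f] the [n]-th partial sum, the derivative
    of [f (t) (1 + t) ^ s] reduces to the boundary term of [gbinom_sum_ode], so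
    by the mean value inequality this product stays close to its value 1 at 0,
    with an error that is the general term of a convergent series. *)
Lemma gbinom_series s y : 0 <= y -> y < 1 ->
  (fun n => \sum_(0 <= j < n) gbinom (- s) j * y%:C ^+ j : R[i]^o) @ \oo -->
  ((cpow (1 + y) s)^-1 : R[i]^o).
Proof.
(* The empty partial sum does not take the value 1 at 0, hence the shift. *)
move=> y0 y1; rewrite -cvg_shiftS.
pose f n (t : R) := \sum_(0 <= j < n) gbinom (- s) j * t%:C ^+ j.
pose w n := n%:R * normc (gbinom (- s) n) * y ^+ n.
pose K := expR (`|complex.Re s| * ln 2) : R.
have cpow_le t : 0 <= t -> t <= y -> normc (cpow (1 + t) s) <= K.
  move=> t0 ty; rewrite normc_cpow ler_expR (le_trans (ler_norm _)) // normrM.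
  rewrite ler_wpM2l // ger0_norm; last by rewrite ln_ge0 // lerDl.
  by rewrite ler_ln ?posrE; lra.
have key n : normc (f n.+1 y * cpow (1 + y) s - 1) <= 2 * K * w n.+1.
  pose g := f n.+1 * (fun t : R => cpow (1 + t) s).
  have g0 : g 0 = 1.
    rewrite /g fctE /f addr0 cpow1 mulr1 big_nat_recl // gbinom0 mulr1 big1 ?addr0 //.
    by move=> j _; rewrite expr0n mulr0.
  pose dg t := cpow (1 + t) s / (1 + t)%:C *
    - (n.+1%:R * gbinom (- s) n.+1 * t%:C ^+ n).
  rewrite -g0 -[f n.+1 y * _]/(g y).
  pose B := K * (n.+1%:R * normc (gbinom (- s) n.+1) * y ^+ n).
  have -> : 2 * K * w n.+1 = 2 * B * y by rewrite /w /B exprSr; ring.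
  apply: (@cmean_value g dg) => // t t0 ty.
    have t1 : 0 < 1 + t by lra.
    have ld : is_derive t 1 (fun u => ln (1 + u)) (1 + t)^-1.
      have := is_derive1_ln t1 => ?.
      apply: (@is_derive_eq _ _ _ (@ln R \o (cst 1 + id))).
      by rewrite add0r /GRing.scale /= mulr1.
    have := is_cderiveM (is_cderive_sum t n.+1 (gbinom (- s)))
      (is_cderive_cexp s ld).
    congr is_cderive; rewrite -[cexp _]/(cpow (1 + t) s) /dg.
    rewrite -(gbinom_sum_ode s t%:C n.+1) rmorphV ?unitfE ?gt_eqF //.
    have : (1 + t)%:C != 0 :> R[i] by rewrite -[0]/(0%:C) (inj_eq (@complexI R)) gt_eqF.
    rewrite rmorphD /= => t1C.
    by field.
  rewrite /dg -rmorphXn /B.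
  move: (cpow (1 + t) s) (cpow_le t t0 ty) (gbinom (- s) n.+1) => c cK b.
  rewrite !normcM normcN !normcM normcV normc_nat !normc_real.
  rewrite ler_pM ?divr_ge0 ?mulr_ge0 ?normc_ge0 //.
    rewrite ler_pdivrMr ?normr_gt0 ?gt_eqF ?(@ger0_norm _ (1 + t)); try lra.
    by rewrite (le_trans cK) // ler_peMr ?expR_ge0 //; lra.
  rewrite ler_wpM2l ?mulr_ge0 ?normc_ge0 // ger0_norm ?exprn_ge0 //.
  by rewrite lerXn2r ?nnegrE.
apply: (@cvgc_bound _ _ _ (fun n => (normc (cpow (1 + y) s))^-1 * (2 * K) * w n.+1)).
  move=> n; have c0 : cpow (1 + y) s != 0 by exact: cexp_neq0.
  have -> : (cpow (1 + y) s)^-1 - f n.+1 y =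
    (cpow (1 + y) s)^-1 * - (f n.+1 y * cpow (1 + y) s - 1) by field.
  rewrite normcM normcV normcN -mulrA ler_wpM2l ?invr_ge0 ?normc_ge0 //.
rewrite -[0](mulr0 ((normc (cpow (1 + y) s))^-1 * (2 * K))).
apply: cvgMr; rewrite (cvg_shiftS w).
by apply: cvg_series_cvg_0; exact: gbinom_moment_cvg.
Qed.

End binomial_series.

(** * The expansion of phi(s, x) *)

(** The series is dominated by a geometric series of ratio [beta ^ (- sigma)]. *)
Lemma growth_summable (R : realType) (b : nat -> R) (beta c sigma : R) :
  1 < beta -> 0 < c -> (forall n, c * beta ^+ n <= b n) -> 0 < sigma ->
  cvgn (series (fun n => expR (- (sigma * ln (b n))))).
Proof.
move=> beta1 c0 bge s0.
have beta0 : 0 < beta by apply: lt_trans beta1.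
pose q := expR (- (sigma * ln beta)).
apply: (@series_le_cvg _ _ (geometric (expR (- (sigma * ln c))) q)).
- by move=> n; exact: expR_ge0.
- by move=> n; rewrite /= mulr_ge0 ?exprn_ge0 ?expR_ge0.
- move=> n; have cb0 : 0 < c * beta ^+ n by rewrite mulr_gt0 ?exprn_gt0.
  rewrite /= /q -expRM_natl -expRD ler_expR.
  have : ln (c * beta ^+ n) <= ln (b n).
    by rewrite ler_ln ?posrE // (lt_le_trans cb0).
  rewrite lnM ?posrE ?exprn_gt0 // lnXn // -[_ *+ n]mulr_natl => h.
  have -> : - (sigma * ln c) + n%:R * - (sigma * ln beta) =
    - (sigma * (ln c + n%:R * ln beta)) by ring.
  by rewrite lerN2 ler_pM2l.
- apply: is_cvg_geometric_series; rewrite ger0_norm ?expR_ge0 //.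
  by rewrite expR_lt1 oppr_lt0 mulr_gt0 // ln_gt0.
Qed.

(** Newton's series at [x / a n] is summed over [n] by [series_exchange].  The
    convergence of each [phi_sum] is established separately rather than read
    off the exchange, because for [x = 0] the double series only sees [j = 0]. *)
Lemma phix_binomial_expansion (R : realType) (a : nat -> int) (s : R[i]) (x : R) :
  (forall n, (1 <= n)%N -> 0 < a n) -> 0 <= x -> x < 1 ->
  cvgn (series (fun n => expR (- (complex.Re s * ln ((a n.+1)%:~R : R))))) ->
  [/\ cvgn (phix_sum a s x),
      (forall j : nat, cvgn (phi_sum a (s + j%:R))) &
      (fun J : nat =>
         \sum_(0 <= j < J)
            gbinom (- s) j * phi a (s + j%:R) * x%:C ^+ j : R[i]^o)
        @ \oo --> phix a s x].
Proof.
move=> apos x0 x1 ucvg.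
pose b n : R := (a n.+1)%:~R.
pose u n := expR (- (complex.Re s * ln (b n))).
have b1 n : 1 <= b n by rewrite ler1z -gtz0_ge1 apos.
have b0 n : 0 < b n by apply: lt_le_trans (b1 n).
have cpow_le n j : normc (cpow (b n) (s + j%:R))^-1 <= u n.
  rewrite cpowDn // normcV normcM -rmorphXn normc_real normc_cpow /u expRN.
  rewrite lef_pV2 ?posrE ?mulr_gt0 ?expR_gt0 ?normr_gt0 ?expf_neq0 ?gt_eqF //.
  by rewrite ler_peMr ?expR_ge0 // ger0_norm ?exprn_ge0 ?exprn_ege1 // ltW.
have phi_sumE t N : phi_sum a t N = \sum_(0 <= n < N) (cpow (b n) t)^-1.
  by rewrite /phi_sum big_add1.
have phi_cvg j : cvgn (phi_sum a (s + j%:R)).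
  have -> : phi_sum a (s + j%:R) = (fun N => \sum_(0 <= n < N) (cpow (b n) (s + j%:R))^-1).
    exact/funext.
  exact: (normc_series_cvg (cpow_le ^~ j)).
pose F n j := gbinom (- s) j * (cpow (b n) (s + j%:R))^-1 * x%:C ^+ j.
pose f n := (cpow (b n + x) s)^-1.
have phixE : phix_sum a s x = (fun N => \sum_(0 <= n < N) f n).
  by apply/funext => N; rewrite /phix_sum big_add1.
have [||||n j|n|] := @series_exchange R F f u
  (fun j => normc (gbinom (- s) j) * x ^+ j).
- by move=> n; exact: expR_ge0.
- by move=> j; rewrite mulr_ge0 ?normc_ge0 ?exprn_ge0.
- exact: ucvg.
- exact: gbinom_cvg.
- rewrite /F -rmorphXn [_ * (_)^-1]mulrC -mulrA normcM [normc (_ * _%:C)]normcM normc_real.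
  by rewrite (ger0_norm (exprn_ge0 _ x0)) ler_wpM2r ?mulr_ge0 ?normc_ge0 ?exprn_ge0.
- have y0 : 0 <= x / b n by rewrite divr_ge0 // ltW.
  have y1 : x / b n < 1 by rewrite ltr_pdivrMr // mul1r (lt_le_trans x1).
  have -> : f n = (cpow (b n) s)^-1 * (cpow (1 + x / b n) s)^-1.
    rewrite /f -invfM -cpowM // ?ltr_pwDl //.
    by rewrite mulrDr mulr1 mulrCA mulfV ?mulr1 // gt_eqF.
  have -> : (fun J => \sum_(0 <= j < J) F n j) = (fun J => (cpow (b n) s)^-1 *
      \sum_(0 <= j < J) gbinom (- s) j * (x / b n)%:C ^+ j).
    apply/funext => J; rewrite mulr_sumr; apply: eq_bigr => j _.
    rewrite /F cpowDn // invfM rmorphM exprMn rmorphV ?unitfE ?gt_eqF // exprVn.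
    ring.
  by apply: cvgMr; exact: gbinom_series.
rewrite /phix phixE => fcvg _ Flim; split=> //.
have limF j : limn (fun N => \sum_(0 <= n < N) F n j : R[i]^o) =
    gbinom (- s) j * phi a (s + j%:R) * x%:C ^+ j.
  apply: (cvg_lim (@norm_hausdorff _ _)).
  have -> : (fun N => \sum_(0 <= n < N) F n j) =
      (fun N => gbinom (- s) j * phi_sum a (s + j%:R) N * x%:C ^+ j).
    by apply/funext => N; rewrite phi_sumE mulr_sumr mulr_suml.
  by apply: cvgMl; apply: cvgMr; exact: phi_cvg.
have -> : (fun J => \sum_(0 <= j < J) gbinom (- s) j * phi a (s + j%:R) * x%:C ^+ j) =
    (fun J => \sum_(0 <= j < J) limn (fun N => \sum_(0 <= n < N) F n j : R[i]^o)).
  by apply/funext => J; apply: eq_bigr => j _; rewrite limF.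
exact: Flim.
Qed.

Theorem corollary3p7 (R : realType) (a : nat -> int) (P : {poly int}) (r : nat)
    (alpha : nat -> R[i])
    (a_rec : linear_recurrence a)
    (P_min : minimal_polynomial P a)
    (P_irr : irreducible_over_rat P)
    (P_deg : size P = r.+1)
    (P_roots : complex_roots P r alpha)
    (alpha_dom : dominant_root r alpha)
    (a_pos : forall n, (1 <= n)%N -> 0 < a n)
    (a_incr : forall m n, (1 <= m)%N -> (m < n)%N -> a m < a n)
    (x : R) (x_ge0 : 0 <= x) (x_lt1 : x < 1)
    (s : R[i]) (s_gt0 : 0 < complex.Re s) :
  [/\ cvgn (phix_sum a s x),
      (forall j : nat, cvgn (phi_sum a (s + j%:R))) &
      (fun J : nat =>
         \sum_(0 <= j < J)
            gbinom (- s) j * phi a (s + j%:R) * x%:C ^+ j : R[i]^o)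
        @ \oo --> phix a s x].
Proof.
have [beta beta1 [c c0 a_ge]] :=
  recurrence_growth P_min P_irr P_deg P_roots alpha_dom a_pos a_incr.
apply: phix_binomial_expansion => //.
exact: growth_summable beta1 c0 a_ge s_gt0.
Qed.
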